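(* For a noiseless wiretap network as described in the context, define $$\mathcal{R}_{\epsilon,o}=\Lambda\Big(\mathrm{Proj}_{\mathcal{S}}\big(\overline{\mathrm{con}}(\Gamma_N^*\cap\Gamma_1\cap\Gamma_2\cap\Gamma_3)\cap\Gamma_4\cap\Gamma_5\cap\Gamma_6\big)\Big).$$ Then $\mathcal{R}_\epsilon^{(w)}\subseteq\mathcal{R}_{\epsilon,o}$.
   Context: Network: an acyclic directed graph $G=(\mathcal{V},\mathcal{E})$, each edge $e$ an error-free bit pipe of finite capacity $c_e$; $\mathrm{In}(v)$, $\mathrm{Out}(v)$ denote incoming/outgoing edges of $v$. Sources $\mathcal{S}$ and terminals $\mathcal{T}$ are disjoint; sources have no incoming edges, terminals no outgoing edges, only sources generate keys; terminal $t$ demands the messages of $\beta(t)\subseteq\mathcal{S}$; $\mathcal{A}_s\subset2^{\mathcal{E}}$ is the collection of possibly wiretapped edge sets. A code of blocklength $n$: source $s$ has message $M_s$ uniform on $[1:2^{\lfloor nr_{m_s}\rfloor}]$ and key $K_s$ uniform on $[1:2^{\lfloor nr_{k_s}\rfloor}]$, all mutually independent; edge $e$ carries $W_e\in\mathcal{W}_e$ (finite), with $W_e=\eta_e(M_s,K_s)$ for $e\in\mathrm{Out}(s)$, $s\in\mathcal{S}$, and $W_e=\eta_e(W_{e'}:e'\in\mathrm{In}(v))$ for $e\in\mathrm{Out}(v)$, $v\notin\mathcal{S}\cup\mathcal{T}$; terminal $t$ outputs $\hat M_{s\to t}=\eta_{t,s}(W_e:e\in\mathrm{In}(t))$ for $s\in\beta(t)$.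 The fixed-length rate of edge $e$ is $r_e^{(f)}=n^{-1}\log_2|\mathcal W_e|$. A rate vector $\mathbf r=(r_s:s\in\mathcal{S})$ is achievable at asymptotically zero error subject to weak secrecy if for every $\epsilon>0$ there is a code of sufficiently large blocklength $n$ with (i) $r_{m_s}^{(n)}\ge r_s-\epsilon$ for all $s$; (ii) $r_e^{(f)}\le c_e$ for all $e$; (iii) $n^{-1}I(M_{\mathcal{S}};W_\alpha)\le\epsilon$ for all $\alpha\in\mathcal{A}_s$, where $M_{\mathcal S}=(M_s:s\in\mathcal S)$, $W_\alpha=(W_e:e\in\alpha)$; (iv) $\Pr(\hat M_{s\to t}\ne M_s)\le\epsilon$ for all $t\in\mathcal{T}$, $s\in\beta(t)$. $\mathcal{R}_\epsilon^{(w)}$ is the set of such rate vectors. Entropy region: let $N=2|\mathcal{S}|+|\mathcal{E}|$ and index $N$ random variables by the labels $m_s,k_s$ ($s\in\mathcal S$) and $e$ ($e\in\mathcal E$). $\mathcal{H}_N$ is the set of real vectors $\mathbf h$ with coordinates $h_\gamma$ indexed by subsets $\gamma$ of these labels ($h_\emptyset=0$); for sets of labels we write e.g. $h_{m_s,k_s,\mathrm{Out}(s)}$ for the coordinate of the union. $\mathbf h$ is entropic if $h_\gamma=H(U_\gamma)$ for some jointly distributed finite-alphabet random variables $(U_{m_s},U_{k_s})_{s},(U_e)_e$, and $\Gamma_N^*$ is the set of entropic vectors. Define: $\Gamma_1=\{\mathbf h: h_{\{m_s,k_s:s\in\mathcal S\}}=\sum_{s\in\mathcal S}(h_{m_s}+h_{k_s})\}$;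 $\Gamma_2=\{\mathbf h: h_{m_s,k_s,\mathrm{Out}(s)}=h_{m_s,k_s}\ \forall s\in\mathcal S\}$; $\Gamma_3=\{\mathbf h: h_{\mathrm{In}(v)\cup\mathrm{Out}(v)}=h_{\mathrm{In}(v)}\ \forall v\in\mathcal V\setminus(\mathcal S\cup\mathcal T)\}$; $\Gamma_4=\{\mathbf h: h_{m_{\beta(t)},\mathrm{In}(t)}=h_{\mathrm{In}(t)}\ \forall t\in\mathcal T\}$ where $m_{\beta(t)}=\{m_s:s\in\beta(t)\}$; $\Gamma_5=\{\mathbf h: h_e\le c_e\ \forall e\in\mathcal E\}$; $\Gamma_6=\{\mathbf h: h_{m_{\mathcal S},\alpha}=h_{m_{\mathcal S}}+h_\alpha\ \forall\alpha\in\mathcal A_s\}$ where $m_{\mathcal S}=\{m_s:s\in\mathcal S\}$. $\overline{\mathrm{con}}(\mathcal A)$ is the smallest closed convex set containing $\mathcal A$. $\mathrm{Proj}_{\mathcal S}:\mathcal H_N\to\mathbb R^{|\mathcal S|}$ maps $\mathbf h$ to $(h_{m_s}:s\in\mathcal S)$. For $\mathcal A\subset\mathbb R^n$, $\Lambda(\mathcal A)=\{\mathbf x\in\mathbb R^n:\mathbf x\le\mathbf y\text{ componentwise for some }\mathbf y\in\mathcal A\}$. *)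

(* Defs.v *)
From Stdlib Require Import Reals.
From HB Require Import structures.
From mathcomp Require Import all_boot all_order all_algebra.
From mathcomp Require Import Rstruct.
Set Implicit Arguments.
Unset Strict Implicit.
Unset Printing Implicit Defensive.
Import GRing.Theory Num.Theory.
Local Open Scope ring_scope.

Definition log2 (x : R) : R := ln x / ln 2.

Section Entropy.
Variables (Om : finType) (p : Om -> R).

Definition is_pmf : Prop := (forall w, 0 <= p w) /\ \sum_(w : Om) p w = 1.

Definition law (T : eqType) (X : Om -> T) (x : T) : R :=
  \sum_(w : Om | X w == x) p w.

(* H(X) = - sum over the (finite) range of X of P(X=x) log2 P(X=x);
   terms with P(X=x)=0 vanish (0 * log 0 = 0). *)
Definition entropy (T : eqType) (X : Om -> T) : R :=
  - \sum_(x <- undup [seq X w | w <- enum Om]) law X x * log2 (law X x).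

Definition mutinf (T1 T2 : eqType) (X : Om -> T1) (Y : Om -> T2) : R :=
  entropy X + entropy Y - entropy (fun w => (X w, Y w)).

Definition prob (P : pred Om) : R := \sum_(w : Om | P w) p w.
End Entropy.

Section Network.
(* vertices V, edges E (parallel edges allowed), edge e goes tl e -> hd e *)
Variables (V E : finType) (tl hd : E -> V).
Variables (S T : {set V}) (beta : V -> {set V}) (c : E -> R)
          (A : {set {set E}}).

Definition adj : rel V := fun u v => [exists e, (tl e == u) && (hd e == v)].
Definition acyclic : Prop := forall e : E, ~~ connect adj (hd e) (tl e).

Definition In_ (v : V) : {set E} := [set e | hd e == v].
Definition Out_ (v : V) : {set E} := [set e | tl e == v].

Definition wiretap_network : Prop :=
  [/\ acyclic /\ [disjoint S & T],
      (forall s, s \in S -> In_ s = set0),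
      (forall t, t \in T -> Out_ t = set0),
      (forall t, t \in T -> beta t \subset S) &
      (forall e, 0 <= c e)].

Definition src : finType := {s : V | s \in S}.

(* A code of blocklength n with |M_s| = 2^(km s), |K_s| = 2^(kk s)
   (km s = floor(n r_{m_s}), kk s = floor(n r_{k_s})).  The underlying
   probability space is the uniform one on all (message, key) tuples, so all
   M_s, K_s are uniform and mutually independent. *)
Definition Omega (km kk : src -> nat) : finType :=
  {dffun forall s : src, 'I_(2 ^ km s)%N * 'I_(2 ^ kk s)%N}.

Definition unif (Om : finType) : Om -> R := fun _ => (#|Om|%:R)^-1.

Definition restr (v : V) (w : E -> nat) : E -> nat :=
  fun e => if hd e == v then w e else 0%N.

(* W e : the symbol on edge e (alphabet [0, We e)), as a function of the
   messages/keys; dec t s : decoding function of terminal t for source s. *)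
Definition is_code (km kk : src -> nat) (We : E -> nat)
    (W : E -> Omega km kk -> nat) : Prop :=
  [/\ (forall e w, (W e w < We e)%N),
      (forall (s : src) e, tl e = val s ->
         exists eta : nat -> nat -> nat,
           forall w, W e w = eta (w s).1 (w s).2) &
      (forall e, tl e \notin S -> tl e \notin T ->
         exists eta : (E -> nat) -> nat,
           forall w, W e w = eta (restr (tl e) (fun e' => W e' w)))].

Definition MS (km kk : src -> nat) (w : Omega km kk) : {ffun src -> nat} :=
  [ffun s => nat_of_ord (w s).1].

Definition Walpha (km kk : src -> nat) (W : E -> Omega km kk -> nat)
    (al : {set E}) (w : Omega km kk) : {ffun E -> nat} :=
  [ffun e => if e \in al then W e w else 0%N].

Definition achievable_w (r : src -> R) : Prop :=
  forall eps : R, 0 < eps ->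
  exists N : nat, forall n : nat, (N <= n)%N -> (0 < n)%N ->
  exists (km kk : src -> nat) (We : E -> nat)
         (W : E -> Omega km kk -> nat) (dec : V -> src -> (E -> nat) -> nat),
  [/\ is_code We W,
      (forall s, r s - eps <= (km s)%:R / n%:R),
      (forall e, log2 ((We e)%:R) / n%:R <= c e),
      (forall al, al \in A ->
         mutinf (@unif (Omega km kk)) (@MS km kk) (Walpha W al) / n%:R <= eps) &
      (forall t (s : src), t \in T -> val s \in beta t ->
         prob (@unif (Omega km kk))
           (fun w => dec t s (restr t (fun e => W e w)) != nat_of_ord (w s).1)
         <= eps)].

(* labels m_s, k_s (s in S) and e (e in E): N = 2|S| + |E| *)
Inductive lab := Lm of src | Lk of src | Le of E.

Definition lab_enc (x : lab) : src + src + E :=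
  match x with Lm s => inl (inl s) | Lk s => inl (inr s) | Le e => inr e end.
Definition lab_dec (x : src + src + E) : lab :=
  match x with inl (inl s) => Lm s | inl (inr s) => Lk s | inr e => Le e end.
Lemma lab_encK : cancel lab_enc lab_dec. Proof. by case. Qed.
HB.instance Definition _ := Equality.copy lab (can_type lab_encK).
HB.instance Definition _ := Finite.copy lab (can_type lab_encK).

Definition vec := {set lab} -> R.

Definition entropic (h : vec) : Prop :=
  exists (Om : finType) (p : Om -> R) (U : lab -> Om -> nat),
    is_pmf p /\
    forall g : {set lab},
      h g = entropy p (fun w => [ffun i => if i \in g then U i w else 0%N]).

(* smallest closed convex set containing a set (closure in the Euclidean
   topology of R^(2^N); the index set is finite) *)
Definition convex_set (C : vec -> Prop) : Prop :=
  forall x y (l : R), 0 <= l -> l <= 1 -> C x -> C y ->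
    C (fun g => l * x g + (1 - l) * y g).
Definition closed_set (C : vec -> Prop) : Prop :=
  forall x, (forall eps : R, 0 < eps ->
               exists y, C y /\ forall g, `|x g - y g| < eps) -> C x.
Definition clcon (P : vec -> Prop) (x : vec) : Prop :=
  forall C, convex_set C -> closed_set C -> (forall y, P y -> C y) -> C x.

Definition mlabs : {set lab} := [set x | if x is Lm _ then true else false].
Definition mklabs : {set lab} :=
  [set x | if x is Le _ then false else true].
Definition elabs (X : {set E}) : {set lab} := Le @: X.

Definition Gamma1 (h : vec) : Prop :=
  h mklabs = \sum_(s : src) (h [set Lm s] + h [set Lk s]).
Definition Gamma2 (h : vec) : Prop :=
  forall s : src, h ([set Lm s; Lk s] :|: elabs (Out_ (val s)))
                  = h [set Lm s; Lk s].
Definition Gamma3 (h : vec) : Prop :=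
  forall v, v \notin S :|: T ->
    h (elabs (In_ v :|: Out_ v)) = h (elabs (In_ v)).
Definition Gamma4 (h : vec) : Prop :=
  forall t, t \in T ->
    h ([set Lm s | s in [pred s : src | val s \in beta t]] :|: elabs (In_ t))
    = h (elabs (In_ t)).
Definition Gamma5 (h : vec) : Prop := forall e, h [set Le e] <= c e.
Definition Gamma6 (h : vec) : Prop :=
  forall al, al \in A -> h (mlabs :|: elabs al) = h mlabs + h (elabs al).

Definition outer_bound (r : src -> R) : Prop :=
  exists h : vec,
    [/\ clcon (fun h' => [/\ entropic h', Gamma1 h', Gamma2 h' & Gamma3 h']) h,
        Gamma4 h, Gamma5 h, Gamma6 h &
        forall s : src, r s <= h [set Lm s]].

End Network.

(* Main.v *)
(* From a code of blocklength n we build an entropic vector satisfying the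
   network equalities Gamma1-Gamma3 exactly and Gamma4, Gamma6 up to o(n) (Fano
   and data processing), divide it by n, and pass to a cluster point.

   Compactness needs every coordinate to be O(n), but the key rates, and the
   message rates of sources demanded by no terminal, are unbounded.  Hence only
   the low n (floor(r_s) + 1) bits of M_s are used as U_{m_s}, the remaining
   bits joining the key; and this enlarged key is replaced by an equivalent one,
   still independent of U_{m_s}, with at most 2^{H(U_{m_s})} prod_e |W_e|
   values: sort the pairs (message, key) above each message value by the symbols
   they produce, and identify the ranks which produce the same symbols for every
   message value.

   Dividing by n stays in the closed convex hull because the zero vector is
   entropic. *)
Require Import Defs.
From Stdlib Require Import Reals FunctionalExtensionality ClassicalEpsilon.
From HB Require Import structures.
From mathcomp Require Import all_boot all_order all_algebra.
From mathcomp Require Import Rstruct ring lra.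
Set Implicit Arguments.
Unset Strict Implicit.
Unset Printing Implicit Defensive.
Import Order.TTheory GRing.Theory Num.Theory.
Local Open Scope ring_scope.

Local Arguments log2 x%_ring_scope.

(** * Binary logarithm *)

Lemma log2E (x : R) : log2 x = ln x / ln 2.
Proof. exact: RdivE. Qed.

Lemma ln2_gt0 : 0 < ln 2.
Proof.
have /RltP := ln_lt_2; apply: lt_trans.
by apply/RltP; apply: Rinv_0_lt_compat; apply: Rlt_0_2.
Qed.

Lemma log2M (x y : R) : 0 < x -> 0 < y -> log2 (x * y) = log2 x + log2 y.
Proof.
by move=> /RltP x0 /RltP y0; rewrite !log2E -mulrDl; congr (_ / _); exact: ln_mult.
Qed.

Lemma log2_1 : log2 1 = 0.
Proof.
have ln1 : ln (1%R : R) = 0 := ln_1.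
by rewrite log2E -R1E ln1 mul0r.
Qed.

Lemma log2V (x : R) : 0 < x -> log2 x^-1 = - log2 x.
Proof.
move=> x0; apply/eqP; rewrite -addr_eq0 -log2M ?invr_gt0 //.
by rewrite mulVf ?lt0r_neq0 // log2_1.
Qed.

Lemma log2X (x : R) k : 0 < x -> log2 (x ^+ k) = k%:R * log2 x.
Proof.
move=> x0; elim: k => [|k IH]; first by rewrite expr0 log2_1 mul0r.
by rewrite exprS log2M ?exprn_gt0 // IH -natr1; ring.
Qed.

Lemma log2_2 : log2 2 = 1.
Proof.
have two : 2%:R = IZR 2 by rewrite -INRE.
by rewrite !log2E two divff // gt_eqF // ln2_gt0.
Qed.

Lemma log2_exp2 k : log2 (2 ^ k)%:R = k%:R.
Proof. by rewrite natrX log2X // log2_2 mulr1. Qed.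

Lemma log2_le_sub1 (x : R) : 0 < x -> log2 x <= (x - 1) / ln 2.
Proof.
move=> x0; rewrite !log2E ler_pM2r ?invr_gt0 ?ln2_gt0 //.
have /RleP := exp_ineq1_le (ln x); rewrite exp_ln; last by apply/RltP.
by rewrite RplusE R1E; lra.
Qed.

Lemma log2_le (x y : R) : 0 < x -> x <= y -> log2 x <= log2 y.
Proof.
move=> x0; rewrite le_eqVlt => /orP[/eqP -> //|xy].
rewrite !log2E ler_pM2r ?invr_gt0 ?ln2_gt0 //; apply/ltW/RltP.
by apply: ln_increasing; apply/RltP.
Qed.

Lemma log2_prod (I : finType) (F : I -> R) :
  (forall i, 0 < F i) -> log2 (\prod_i F i) = \sum_i log2 (F i).
Proof.
move=> F0; suff [] : 0 < \prod_i F i /\ log2 (\prod_i F i) = \sum_i log2 (F i) by [].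
elim/big_rec2: _ => [|i y x _ [x0 IH]]; first by rewrite log2_1.
by rewrite mulr_gt0 // log2M // IH.
Qed.

(** * Shannon inequalities on a finite probability space *)

Lemma mutinfE (Om : finType) (p : Om -> R) (T1 T2 : eqType) (X : Om -> T1)
    (Y : Om -> T2) :
  mutinf p X Y = entropy p X + entropy p Y - entropy p (fun w => (X w, Y w)).
Proof. by []. Qed.

Lemma ler_sum_uniq_sub (T : eqType) (r1 r2 : seq T) (q : T -> R) :
  (forall x, 0 <= q x) -> uniq r1 -> {subset r1 <= r2} ->
  \sum_(x <- r1) q x <= \sum_(x <- r2) q x.
Proof.
elim: r1 r2 => [|x r1 IH] r2 q0 /=; first by rewrite big_nil sumr_ge0.
move=> /andP[xr1 u1] sub; have xr2 : x \in r2 by apply: sub; rewrite mem_head.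
rewrite big_cons (perm_big _ (perm_to_rem xr2)) big_cons lerD2l IH // => y yr1.
have : y \in x :: rem x r2 by rewrite -(perm_mem (perm_to_rem xr2)) sub // inE yr1 orbT.
by rewrite inE => /orP[/eqP yx|//]; rewrite -yx yr1 in xr1.
Qed.

Section EntropyInequalities.
Variables (Om : finType) (p : Om -> R).
Hypotheses (p_gt0 : forall w, 0 < p w) (p_sum1 : \sum_w p w = 1).

Lemma law_gt0 (T : eqType) (X : Om -> T) w : 0 < law p X (X w).
Proof.
rewrite /law (bigD1 w) //= ltr_wpDr // sumr_ge0 // => w' _.
exact: ltW.
Qed.

Lemma law_le1 (T : eqType) (X : Om -> T) x : law p X x <= 1.
Proof.
rewrite -p_sum1 /law [leRHS](bigID (fun w => X w == x)) /= lerDl.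
by rewrite sumr_ge0 // => w _; exact: ltW.
Qed.

Lemma sum_undup_image (T : eqType) (X : Om -> T) (F : Om -> R) :
  \sum_(x <- undup [seq X w | w <- enum Om]) \sum_(w | X w == x) F w
  = \sum_w F w.
Proof.
rewrite (exchange_big_dep xpredT) //=; apply: eq_bigr => w _.
rewrite -big_filter (perm_big [:: X w]) ?big_seq1 //.
apply: uniq_perm => //; first by rewrite filter_uniq ?undup_uniq.
move=> x; rewrite mem_filter mem_undup inE eq_sym.
by case: eqP => //= ->; rewrite map_f // mem_enum.
Qed.

(** Grouping outcomes by their value turns the sum over the range into an expectation over [Om], so
    that variables with different codomains can be compared outcome by outcome. *)
Lemma entropyE (T : eqType) (X : Om -> T) :
  entropy p X = - \sum_w p w * log2 (law p X (X w)).
Proof.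
rewrite /entropy RoppE; congr (- _); rewrite -(sum_undup_image X).
apply: eq_bigr => x _; rewrite {1}/law mulr_suml.
by apply: eq_bigr => w /eqP ->.
Qed.

Lemma entropy_ge0 (T : eqType) (X : Om -> T) : 0 <= entropy p X.
Proof.
rewrite entropyE -sumrN sumr_ge0 // => w _; rewrite -mulrN mulr_ge0 //; first exact: ltW.
by rewrite oppr_ge0 -log2_1 log2_le ?law_gt0 ?law_le1.
Qed.

(** The fibre of [Y] through an outcome lies inside the fibre of [X], so its law is pointwise
    smaller. *)
Lemma entropy_mono (T1 T2 : eqType) (X : Om -> T1) (Y : Om -> T2) :
  (forall w w', Y w = Y w' -> X w = X w') -> entropy p X <= entropy p Y.
Proof.
move=> XY; rewrite !entropyE lerN2; apply: ler_sum => w _.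
rewrite ler_pM2l // log2_le ?law_gt0 // /law.
rewrite [leRHS](bigID (fun w' => Y w' == Y w)) /=.
rewrite [X in _ <= X + _](eq_bigl (fun w' => Y w' == Y w)); last first.
  move=> w'; case: (Y w' =P Y w) => [/XY ->|]; first by rewrite eqxx.
  by rewrite andbF.
by rewrite lerDl sumr_ge0 // => w' _; exact: ltW.
Qed.

Lemma entropy_eq (T1 T2 : eqType) (X : Om -> T1) (Y : Om -> T2) :
  (forall w w', X w = X w' <-> Y w = Y w') -> entropy p X = entropy p Y.
Proof.
by move=> XY; apply/le_anti/andP; split; apply: entropy_mono => w w' /XY.
Qed.

(** Jensen's inequality for the logarithm, obtained by averaging [log2 x <= (x - 1) / ln 2]. *)
Lemma mean_log2_le (F : Om -> R) :
  (forall w, 0 < F w) -> \sum_w p w * F w <= 1 ->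
  \sum_w p w * log2 (F w) <= 0.
Proof.
move=> F0 F1; apply: (@le_trans _ _ (\sum_w p w * ((F w - 1) / ln 2))).
  by apply: ler_sum => w _; rewrite ler_pM2l // log2_le_sub1.
rewrite (eq_bigr (fun w => (p w * F w - p w) / ln 2)); last first.
  by move=> w _; ring.
rewrite -mulr_suml sumrB p_sum1 pmulr_lle0 ?invr_gt0 ?ln2_gt0 //.
by rewrite subr_le0.
Qed.

(** Cross-entropy bound: Jensen for the ratio [q (X w) / law p X (X w)], whose mean is the total of
    [q] over the range of [X]. *)
Lemma entropy_gibbs (T : eqType) (X : Om -> T) (q : T -> R) :
  (forall x, 0 < q x) ->
  \sum_(x <- undup [seq X w | w <- enum Om]) q x <= 1 ->
  entropy p X <= - \sum_w p w * log2 (q (X w)).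
Proof.
move=> q0 q1; rewrite entropyE lerN2 -subr_le0 -sumrB.
rewrite (eq_bigr (fun w => p w * log2 (q (X w) * (law p X (X w))^-1))).
  apply: mean_log2_le => [w|]; first by rewrite divr_gt0 ?law_gt0.
  apply: le_trans q1; rewrite -(sum_undup_image X) le_eqVlt.
  apply/orP; left; apply/eqP.
  apply: eq_big_seq => x.
  rewrite mem_undup => /mapP[w0 _ ->].
  rewrite (eq_bigr (fun w => p w * (q (X w0) / law p X (X w0)))).
    by rewrite -mulr_suml mulrC divfK // lt0r_neq0 // law_gt0.
  by move=> w /eqP ->.
by move=> w _; rewrite log2M ?invr_gt0 ?law_gt0 // log2V ?law_gt0 // mulrDr mulrN.
Qed.

Lemma entropy_le_log2 (X : Om -> nat) B :
  (forall w, X w < B)%N -> entropy p X <= log2 B%:R.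
Proof.
move=> XB; have B0 : 0 < B%:R :> R.
  have [w _] : exists w : Om, true.
    apply/existsP; apply: contraT; rewrite negb_exists => /forallP n.
    by move: p_sum1; rewrite big1 => [/eqP|w]; rewrite ?(eq_sym 0) ?oner_eq0 //; have := n w.
  by rewrite ltr0n; apply: leq_trans (XB w).
have := @entropy_gibbs _ X (fun=> B%:R^-1) _ _.
rewrite -mulr_suml p_sum1 mul1r log2V // opprK; apply.
  by move=> _; rewrite invr_gt0.
rewrite big_const_seq count_predT iter_addr_0 -[_ *+ _]mulr_natl ler_pdivrMr // mul1r.
rewrite ler_nat -[leqRHS](size_iota 0); apply: uniq_leq_size; first exact: undup_uniq.
by move=> x; rewrite mem_undup => /mapP[w _ ->]; rewrite mem_iota add0n XB.
Qed.

(* Shannon's inequality I(X; Y | Z) >= 0, where Z is a function of X and of Y. *)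
Lemma entropy_submod (T1 T2 T3 : eqType) (X : Om -> T1) (Y : Om -> T2)
    (Z : Om -> T3) :
  (forall w w', X w = X w' -> Z w = Z w') ->
  (forall w w', Y w = Y w' -> Z w = Z w') ->
  entropy p Z + entropy p (fun w => (X w, Y w)) <= entropy p X + entropy p Y.
Proof.
move=> XZ YZ; pose J w := (X w, Y w).
rewrite !entropyE -!opprD lerN2 -!big_split /= -subr_le0 -sumrB.
rewrite (eq_bigr (fun w => p w * log2 (law p X (X w) * law p Y (Y w) *
  (law p Z (Z w) * law p J (J w))^-1))); last first.
  move=> w _; rewrite log2M ?invr_gt0 ?mulr_gt0 ?law_gt0 //.
  by rewrite log2V ?mulr_gt0 ?law_gt0 // !log2M ?law_gt0 //; ring.
apply: mean_log2_le => [w|]; first by rewrite divr_gt0 ?mulr_gt0 ?law_gt0.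
pose G w := p w / (law p Z (Z w) * law p J (J w)).
have G0 w : 0 < G w by rewrite divr_gt0 ?mulr_gt0 ?law_gt0.
rewrite (eq_bigr (fun w => \sum_(w1 | X w1 == X w) \sum_(w2 | Y w2 == Y w)
   p w1 * p w2 * G w)); last first.
  move=> w _; rewrite [LHS](_ : _ = law p X (X w) * law p Y (Y w) * G w);
    last by rewrite /G mulrCA.
  rewrite /law big_distrlr /= mulr_suml.
  by apply: eq_bigr => w1 _; rewrite mulr_suml; apply: eq_bigr => w2 _.
rewrite (exchange_big_dep xpredT) //= -p_sum1; apply: ler_sum => w1 _.
(* Only pairs with [Z w2 = Z w1] survive, since [w] shares [X] with [w1] and [Y] with [w2], and each
   of [X], [Y] determines [Z]. *)
rewrite (exchange_big_dep (fun w2 => Z w2 == Z w1)) /=; last first.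
  by move=> w w2 /eqP w1w /eqP w2w; rewrite (YZ _ _ w2w) (XZ _ _ w1w).
apply: (@le_trans _ _ (\sum_(w2 | Z w2 == Z w1) p w1 * p w2 / law p Z (Z w1))).
  apply: ler_sum => w2 _; rewrite -mulr_sumr ler_pM2l ?mulr_gt0 //.
  (* If some [w0] agrees with [w1] under [X] and with [w2] under [Y], the inner sum runs over a
     fibre of [J] and equals [(law p Z (Z w1))^-1]; otherwise it is empty. *)
  have [/existsP[w0 /andP[/eqP X0 /eqP Y0]]|] :=
    boolP [exists w, (X w1 == X w) && (Y w2 == Y w)].
    rewrite (eq_bigl (fun w => J w == J w0)); last first.
      by move=> w; rewrite xpair_eqE X0 Y0 eq_sym [Y _ == _]eq_sym.
    rewrite (eq_bigr (fun w => p w * (law p Z (Z w1) * law p J (J w0))^-1)).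
      rewrite -mulr_suml invfM mulrCA divff ?mulr1 // lt0r_neq0 //.
      exact: (law_gt0 J).
    by move=> w /eqP ww0; rewrite /G ww0; case: ww0 => Xw _;
       rewrite (XZ w w1) // X0.
  rewrite negb_exists => /forallP n; rewrite big_pred0.
    by rewrite invr_ge0 ltW ?law_gt0.
  by move=> w; apply/negbTE.
by rewrite -mulr_suml -mulr_sumr mulfK // lt0r_neq0 // law_gt0.
Qed.

Lemma entropy_subadd (T1 T2 : eqType) (X : Om -> T1) (Y : Om -> T2) :
  entropy p (fun w => (X w, Y w)) <= entropy p X + entropy p Y.
Proof.
have := @entropy_submod _ _ _ X Y (fun=> tt) (fun _ _ _ => erefl) (fun _ _ _ => erefl).
by apply: le_trans; rewrite lerDr entropy_ge0.
Qed.

Lemma mutinf_ge0 (T1 T2 : eqType) (X : Om -> T1) (Y : Om -> T2) :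
  0 <= mutinf p X Y.
Proof. by rewrite mutinfE subr_ge0 entropy_subadd. Qed.

(** Submodularity for [X] and the pair [(f, Y)], both of which determine [f]. *)
Lemma data_processing (T0 T1 T2 : eqType) (X : Om -> T1) (Y : Om -> T2)
    (f : Om -> T0) :
  (forall w w', X w = X w' -> f w = f w') -> mutinf p f Y <= mutinf p X Y.
Proof.
move=> Xf; rewrite !mutinfE.
have := @entropy_submod _ _ _ X (fun w => (f w, Y w)) f Xf _.
rewrite (_ : entropy p (fun w => (X w, (f w, Y w))) = entropy p (fun w => (X w, Y w))).
  by move=> /(_ (fun w w' => fun '(erefl) => erefl)); lra.
by apply: entropy_eq => w w'; split=> [[-> _ ->]|[] /[dup] /Xf -> -> ->].
Qed.

(** [D] records whether the estimate is correct and, if not, the true value. So [D] and [Y]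
    determine [X], and only the entropy of [D] has to be bounded. *)
Lemma fano (T : eqType) (X : Om -> nat) (Y : Om -> T) (g : Om -> nat) B :
  (0 < B)%N -> (forall w, X w < B)%N ->
  (forall w w', Y w = Y w' -> g w = g w') ->
  entropy p (fun w => (X w, Y w))
  <= entropy p Y + (1 + prob p (fun w => g w != X w) * log2 B%:R).
Proof.
move=> B0 XB Yg; pose D w := if g w == X w then 0%N else (X w).+1.
apply: (@le_trans _ _ (entropy p (fun w => (D w, Y w)))).
  apply: entropy_mono => w w' [DD YY]; rewrite YY; congr (_, _).
  move: DD; rewrite /D; case: eqP => [<-|_]; case: eqP => [<-|_] //.
    by move=> _; exact: Yg.
  by case.
apply: (le_trans (entropy_subadd _ _)); rewrite addrC lerD2l.
(* The comparison law gives mass 1/2 to success and spreads 1/2 evenly over the [B] error values: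
   one bit is always paid, and [log2 B] more upon an error. *)
pose q (d : nat) : R := if d == 0%N then 2^-1 else (2 * B%:R)^-1.
have BR : 0 < B%:R :> R by rewrite ltr0n.
apply: (@le_trans _ _ (- \sum_w p w * log2 (q (D w)))).
  apply: entropy_gibbs => [d|]; first by rewrite /q; case: ifP; rewrite invr_gt0 ?mulr_gt0.
  apply: (@le_trans _ _ (\sum_(d <- iota 0 B.+1) q d)).
    apply: ler_sum_uniq_sub => [d||d]; last 1 first.
    - rewrite mem_undup => /mapP[w _ ->]; rewrite mem_iota /D.
      by case: ifP => // _; rewrite /= add0n ltnS XB.
    - by rewrite /q; case: ifP; rewrite invr_ge0 ?mulr_ge0.
    - exact: undup_uniq.
  rewrite /= big_cons /q /= (eq_big_seq (fun=> (2 * B%:R)^-1)); last first.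
    by move=> d; rewrite mem_iota; case: d.
  rewrite big_const_seq count_predT iter_addr_0 size_iota.
  rewrite -[X in _ + X <= _]mulr_natl.
  have -> : B%:R * (2 * B%:R)^-1 = 2^-1 :> R by field; rewrite lt0r_neq0.
  by lra.
rewrite -sumrN (eq_bigr (fun w => p w + (if g w != X w then p w * log2 B%:R else 0))).
  by rewrite big_split /= p_sum1 -big_mkcond /= -mulr_suml.
move=> w _; rewrite /D /q; case: (g w == X w) => /=.
  by rewrite log2V // log2_2; ring.
by rewrite log2V ?mulr_gt0 // log2M // log2_2; ring.
Qed.

End EntropyInequalities.

(** * Functional representation over fibres of equal size *)

Section FunctionalRepresentation.
Variables (D X : finType) (x : D -> X) (N B : nat) (f : D -> nat).
Hypotheses (fibre_card : forall a, #|[pred d | x d == a]| = N).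
Hypotheses (f_lt : forall d, (f d < B)%N).

Let fibre a := sort (relpre f leq) (enum [pred d | x d == a]).
Let value a i := nth 0%N (map f (fibre a)) i.
Let rank d := index d (fibre (x d)).
Let total i := (\sum_a value a i)%N.

Let mem_fibre a d : (d \in fibre a) = (x d == a).
Proof. by rewrite mem_sort mem_enum. Qed.

Let size_fibre a : size (fibre a) = N.
Proof. by rewrite size_sort -cardE fibre_card. Qed.

Let uniq_fibre a : uniq (fibre a).
Proof. by rewrite sort_uniq enum_uniq. Qed.

Let rank_lt d : (rank d < N)%N.
Proof. by rewrite -(size_fibre (x d)) index_mem mem_fibre. Qed.

Let value_rank d : value (x d) (rank d) = f d.
Proof.
by rewrite /value (nth_map d) ?nth_index ?mem_fibre // size_fibre rank_lt.
Qed.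

Let value_mono a i j : (i <= j < N)%N -> (value a i <= value a j)%N.
Proof.
move=> /andP[ij jN]; rewrite /value.
have srt : sorted leq (map f (fibre a)).
  rewrite sorted_map; apply: sort_sorted => d d'; exact: leq_total.
apply: (sorted_leq_nth leq_trans leqnn 0%N srt) => //; rewrite inE size_map size_fibre //.
exact: leq_ltn_trans jN.
Qed.

(** The terms of the two sums are ordered pairwise, so equal sums force equal terms. *)
Let total_inj a i j : (i <= j < N)%N -> total i = total j -> value a i = value a j.
Proof.
move=> ijN tot.
have := @leqif_sum X xpredT (fun b => value b i == value b j) (value^~ i) (value^~ j).
move=> /(_ (fun b _ => leqif_eq (value_mono b ijN))) [_].
by rewrite -/(total i) -/(total j) tot eqxx => /esym/forallP/(_ a)/eqP.
Qed.

(* The fibres are sorted by f, so in each of them the value of f at a given rank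
   is nondecreasing in the rank: the sum over the fibres of these values, which
   is taken as z, determines each of them. *)
Lemma functional_representation :
  exists z : D -> nat,
    [/\ forall d, (z d < #|X| * B)%N,
        forall d d', x d = x d' -> z d = z d' -> f d = f d' &
        forall a k, (#|[pred d | (x d == a) && (z d == k)]| * #|X|
                     = #|[pred d | z d == k]|)%N].
Proof.
exists (fun d => total (rank d)); split=> [d|d d' xx zz|a k].
- have X0 : (0 < #|X|)%N by apply/card_gt0P; exists (x d).
  have B0 : (0 < B)%N by apply: leq_ltn_trans (f_lt d).
  apply: (@leq_ltn_trans (\sum_(a : X) B.-1)%N).
    apply: leq_sum => a _; rewrite -ltnS prednK //.
    have := rank_lt d; rewrite -(size_fibre a) => lt.
    by rewrite /value (nth_map d) ?f_lt // size_fibre.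
  by rewrite sum_nat_const ltn_pmul2l // prednK.
- rewrite -value_rank -(value_rank d') -xx.
  have [le|/ltnW le] := leqP (rank d) (rank d').
    by apply: total_inj => //; rewrite le rank_lt.
  by apply/esym/total_inj => //; rewrite le rank_lt.
(* The ranks in every fibre are exactly the numbers below [N], and [total] does not depend on the
   fibre. Hence each fibre has equally many points with a given value of [z]. *)
- have cnt b : #|[pred d | (x d == b) && (total (rank d) == k)]|
      = count (fun i => total i == k) (iota 0 N).
    rewrite cardE -size_filter; set s := enum _.
    have -> : [seq i <- iota 0 N | total i == k] =
      [seq i <- map (index^~ (fibre b)) (fibre b) | total i == k].
      congr filter; apply: (@eq_from_nth _ 0%N); rewrite size_iota ?size_map ?size_fibre //.
      move=> i iN; have [d0 _] : exists d0 : D, d0 \in fibre b.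
        by move: iN; rewrite -(size_fibre b); case: (fibre b) => // d0 s0; exists d0; rewrite mem_head.
      by rewrite nth_iota // (nth_map d0) ?size_fibre // index_uniq ?size_fibre.
    rewrite filter_map size_map; apply: perm_size; apply: uniq_perm.
    + exact: enum_uniq.
    + by rewrite filter_uniq.
    + move=> d; rewrite mem_enum mem_filter inE /= mem_fibre andbC.
      by rewrite /rank; case: (x d =P b) => [->|]; rewrite ?andbF.
  rewrite cnt mulnC -sum_nat_const -[RHS]sum1_card.
  rewrite (partition_big x xpredT) //=; apply: eq_bigr => b _.
  by rewrite -(cnt b) -sum1_card; apply: eq_bigl => d; rewrite !inE andbC.
Qed.

End FunctionalRepresentation.

(** * Uniform laws: balanced variables and product spaces *)

Section UniformLaw.

Lemma unif_gt0 (Om : finType) (w : Om) : 0 < unif w.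
Proof. by rewrite /unif invr_gt0 ltr0n; apply/card_gt0P; exists w. Qed.

Lemma unif_sum1 (Om : finType) : (0 < #|Om|)%N -> \sum_(w : Om) unif w = 1.
Proof.
by move=> Om0; rewrite sumr_const -[_ *+ _]mulr_natl mulfV // pnatr_eq0 -lt0n.
Qed.

Lemma unif_is_pmf (Om : finType) : (0 < #|Om|)%N -> is_pmf (@unif Om).
Proof. by move=> Om0; split; [move=> w; exact/ltW/unif_gt0|exact: unif_sum1]. Qed.

Lemma law_unif (Om : finType) (T : eqType) (X : Om -> T) x :
  law (@unif Om) X x = #|[pred w | X w == x]|%:R / #|Om|%:R.
Proof.
by rewrite /law sumr_const [RHS]mulr_natl.
Qed.

Section Balanced.
Variables (Om X : finType) (x : Om -> X) (N : nat).
Hypotheses (Om0 : (0 < #|Om|)%N) (fib : forall a, #|[pred w | x w == a]| = N).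

Let OmE : #|Om| = (#|X| * N)%N.
Proof.
rewrite -sum_nat_const -sum1_card (partition_big x xpredT) //=.
by apply: eq_bigr => a _; rewrite -(fib a) -sum1_card; apply: eq_bigl => w.
Qed.

Let XN : (#|X|%:R != 0 :> R) /\ (N%:R != 0 :> R).
Proof. by move: Om0; rewrite OmE muln_gt0 !pnatr_eq0 -!lt0n => /andP. Qed.

Lemma law_balanced a : law (@unif Om) x a = #|X|%:R^-1.
Proof. by case: XN => X1 N1; rewrite law_unif fib OmE natrM; field; rewrite X1 N1. Qed.

(** Turns the counting conclusion of [functional_representation] into probabilistic independence. *)
Lemma law_balanced_indep (z : Om -> nat) :
  (forall a k, (#|[pred w | (x w == a) && (z w == k)]| * #|X|
                = #|[pred w | z w == k]|)%N) ->
  forall a k, law (@unif Om) (fun w => (x w, z w)) (a, k)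
            = law (@unif Om) x a * law (@unif Om) z k.
Proof.
case: XN => X1 N1 ind a k; rewrite !law_unif fib -(ind a).
rewrite (eq_card (B := [pred w | (x w == a) && (z w == k)])); last first.
  by move=> w; rewrite !inE xpair_eqE.
by rewrite OmE !natrM; field; rewrite X1 N1.
Qed.

End Balanced.

Variables (I : finType) (D : I -> finType).
Let Om : finType := {dffun forall i, D i}.

Lemma card_dffun_forall (Q : forall i, pred (D i)) :
  #|[pred w : Om | [forall i, Q i (w i)]]| = (\prod_i #|Q i|)%N.
Proof.
transitivity #|(family Q : simpl_pred {dffun forall i, D i})|.
  by apply: eq_card => w; rewrite !inE.
by rewrite card_family foldrE big_map /= big_enum.
Qed.

Lemma card_dffunE : #|Om| = (\prod_i #|D i|)%N.
Proof. by rewrite card_dep_ffun foldrE big_map /= big_enum. Qed.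

Hypothesis D0 : forall i, (0 < #|D i|)%N.

Lemma card_dffun_gt0 : (0 < #|Om|)%N.
Proof. by rewrite card_dffunE prodn_gt0. Qed.

(** [J] is any variable with the same fibres as the tuple of the [X i], which covers joint variables
    encoded as functions on labels. These fibres are boxes, so their cardinalities factor. *)
Lemma law_product (T : eqType) (J : Om -> T) (T' : I -> eqType)
    (X : forall i, D i -> T' i) :
  (forall w w', (J w == J w') = [forall i, X i (w i) == X i (w' i)]) ->
  forall w, law (@unif Om) J (J w)
            = \prod_i law (@unif (D i)) (X i) (X i (w i)).
Proof.
move=> JX w; rewrite law_unif card_dffunE.
have -> : #|[pred w' | J w' == J w]| = (\prod_i #|[pred d | X i d == X i (w i)]|)%N.
  by rewrite -card_dffun_forall; apply: eq_card => w'; rewrite !inE JX.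
rewrite !natr_prod -prodf_div.
by apply: eq_bigr => i _; rewrite law_unif.
Qed.

Lemma law_marginal (T : eqType) i (X : D i -> T) (w : Om) :
  law (@unif Om) (fun w : Om => X (w i)) (X (w i)) = law (@unif (D i)) X (X (w i)).
Proof.
rewrite !law_unif card_dffunE.
(* [Q i] is the fibre of [X], and [Q j] is everything for [j] other than [i]. As [D j] and [D i] are
   different types, the test goes through tuples [w'] with [w' j = d], which avoids a cast. *)
pose Q j := [pred d : D j | [forall w' : Om, (w' j == d) ==> (j == i) ==> (X (w' i) == X (w i))]].
have QE (w' : Om) : [forall j, Q j (w' j)] = (X (w' i) == X (w i)).
  apply/forallP/eqP => [/(_ i)/forallP/(_ w')|Xw j]; first by rewrite !eqxx => /eqP.
  apply/forallP => w2; apply/implyP => /eqP w2j; apply/implyP => /eqP ji.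
  by subst j; rewrite w2j Xw.
have -> : #|[pred w' : Om | X (w' i) == X (w i)]| = (\prod_j #|Q j|)%N.
  by rewrite -card_dffun_forall; apply: eq_card => w'; rewrite !inE -QE.
rewrite (bigD1 i) //= (_ : #|[pred d | X d == X (w i)]| = #|Q i|); last first.
  apply: eq_card => d; rewrite !inE; apply/eqP/forallP => [Xd w2|].
    by apply/implyP => /eqP ->; rewrite Xd !eqxx.
  (* Some tuple passes through [d], so the quantification in [Q i] is not vacuous. *)
  have [w2 w2i] : exists w2 : Om, w2 i = d.
    by exists [ffun j => dfwith (fun j => w j) d j]; rewrite ffunE dfwith_in.
  by move=> /(_ w2); rewrite w2i !eqxx => /eqP.
rewrite [in X in _ / X](bigD1 i) //= !natrM.
rewrite (eq_bigr (fun j => #|D j|)); last first.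
  move=> j ji; apply: eq_card => d; rewrite !inE; apply/forallP => w2.
  by rewrite (negbTE ji) implybT.
set P := (\prod_(j | _) _)%N; have P0 : P%:R != 0 :> R.
  by rewrite pnatr_eq0 -lt0n prodn_gt0.
have Di0 : #|D i|%:R != 0 :> R by rewrite pnatr_eq0 -lt0n.
by field; rewrite P0 Di0.
Qed.

Lemma entropy_product (T : eqType) (J : Om -> T) (T' : I -> eqType)
    (X : forall i, D i -> T' i) :
  (forall w w', (J w == J w') = [forall i, X i (w i) == X i (w' i)]) ->
  entropy (@unif Om) J = \sum_i entropy (@unif Om) (fun w => X i (w i)).
Proof.
move=> JX; rewrite entropyE.
rewrite [RHS](eq_bigr _ (fun i _ => entropyE (@unif Om) (fun w : Om => X i (w i)))).
rewrite sumrN exchange_big /=; congr (- _); apply: eq_bigr => w _.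
rewrite -mulr_sumr (law_product JX) log2_prod; last first.
  by move=> i; apply: law_gt0 => d; exact: unif_gt0.
by congr (_ * _); apply: eq_bigr => i _; rewrite law_marginal.
Qed.

End UniformLaw.

Lemma entropy_indep (Om : finType) (p : Om -> R) (T1 T2 : eqType)
    (X : Om -> T1) (Y : Om -> T2) : (forall w, 0 < p w) ->
  (forall w, law p (fun w => (X w, Y w)) (X w, Y w)
             = law p X (X w) * law p Y (Y w)) ->
  entropy p (fun w => (X w, Y w)) = entropy p X + entropy p Y.
Proof.
move=> p0 ind; rewrite !entropyE -opprD -big_split /=; congr (- _).
by apply: eq_bigr => w _; rewrite ind log2M ?law_gt0 // mulrDr.
Qed.

Lemma entropy_const_law (Om : finType) (p : Om -> R) (T : eqType) (X : Om -> T) q :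
  \sum_w p w = 1 -> (forall w, law p X (X w) = q) -> entropy p X = - log2 q.
Proof.
move=> p1 lawX; rewrite entropyE; congr (- _).
rewrite (eq_bigr (fun w => p w * log2 q)) => [|w _]; last by rewrite lawX.
by rewrite -mulr_suml p1 mul1r.
Qed.

Lemma entropy_const_fun (Om : finType) (p : Om -> R) (T : eqType) (X : Om -> T) :
  \sum_w p w = 1 -> (forall w w', X w = X w') -> entropy p X = 0.
Proof.
move=> p1 cst; have law1 w : law p X (X w) = 1.
  by rewrite -p1; apply: eq_bigl => w'; rewrite (cst w' w) eqxx.
by rewrite (entropy_const_law p1 law1) log2_1 oppr0.
Qed.

(** * Vectors of joint entropies *)

Section JointEntropy.
Variables (I Om : finType) (p : Om -> R) (U : I -> Om -> nat).
Hypotheses (p_gt0 : forall w, 0 < p w) (p_sum1 : \sum_w p w = 1).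

Definition proj (g : {set I}) (w : Om) : {ffun I -> nat} :=
  [ffun i => if i \in g then U i w else 0%N].

Definition hvec (g : {set I}) : R := entropy p (proj g).

Lemma projP g w w' :
  proj g w = proj g w' <-> (forall i, i \in g -> U i w = U i w').
Proof.
split=> [/ffunP e i ig|e]; first by have := e i; rewrite !ffunE ig.
by apply/ffunP => i; rewrite !ffunE; case: ifP => // /e.
Qed.

Lemma hvec_ge0 g : 0 <= hvec g.
Proof. exact: entropy_ge0. Qed.

Lemma hvec_mono (g1 g2 : {set I}) : g1 \subset g2 -> hvec g1 <= hvec g2.
Proof.
move=> /subsetP sub; apply: entropy_mono => // w w' /projP e.
by apply/projP => i /sub/e.
Qed.

(** Functional dependence as an equality of entropies, the shape of [Gamma2] and [Gamma3]. *)
Lemma hvec_determined (g1 g2 : {set I}) : g1 \subset g2 ->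
  (forall w w', (forall i, i \in g1 -> U i w = U i w') ->
     forall i, i \in g2 -> U i w = U i w') ->
  hvec g2 = hvec g1.
Proof.
move=> sub det; apply/le_anti/andP; split; last exact: hvec_mono.
by apply: entropy_mono => // w w' /projP e; apply/projP; exact: det.
Qed.

Lemma hvec1 i : hvec [set i] = entropy p (U i).
Proof.
apply: entropy_eq => // w w'; rewrite projP.
by split=> [|e j /set1P -> //]; apply; rewrite set11.
Qed.

Lemma hvecU g1 g2 : hvec (g1 :|: g2) = entropy p (fun w => (proj g1 w, proj g2 w)).
Proof.
apply: entropy_eq => // w w'; split=> [/projP e|[/projP e1 /projP e2]].
  by congr (_, _); apply/projP => i ig; apply: e; rewrite inE ig ?orbT.
by apply/projP => i /setUP[/e1|/e2].
Qed.

Lemma hvecU1 i g : hvec (i |: g) = entropy p (fun w => (U i w, proj g w)).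
Proof.
apply: entropy_eq => // w w'; split=> [/projP e|[e1 /projP e2]].
  congr (_, _); first by apply: e; rewrite setU11.
  by apply/projP => j jg; apply: e; rewrite inE jg orbT.
by apply/projP => j /setU1P[->|/e2].
Qed.

(** Labels are added one at a time and the costs accumulate. The step is assumed for every superset
    of [g0], since other labels of [r] may already be present when [i] is added. *)
Lemma hvec_chain (g0 : {set I}) (r : seq I) (delta : I -> R) :
  (forall i (g : {set I}), i \in r -> g0 \subset g -> hvec (i |: g) <= hvec g + delta i) ->
  hvec ([set i in r] :|: g0) <= hvec g0 + \sum_(i <- r) delta i.
Proof.
elim: r => [|i r IH] step.
  by rewrite big_nil addr0 hvec_mono //; apply/subsetP => i; rewrite !inE.
rewrite big_cons addrCA addrC set_cons -setUA.
apply: le_trans (step i _ (mem_head _ _) (subsetUr _ _)) _.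
rewrite lerD2r; apply: IH => j g jr; apply: step.
by rewrite inE jr orbT.
Qed.

(** Reduces the boundedness of all coordinates, needed for compactness, to that of the
    singletons. *)
Lemma hvec_le_sum g : hvec g <= \sum_i hvec [set i].
Proof.
apply: (@le_trans _ _ (hvec ([set i in enum I] :|: set0))).
  by apply: hvec_mono; apply/subsetP => i _; rewrite !inE mem_enum.
rewrite -big_enum /=.
have h0 : hvec set0 = 0.
  apply: entropy_const_fun => // w w'; apply/projP => i.
  by rewrite inE.
have := @hvec_chain set0 (enum I) (fun i => hvec [set i]) _; rewrite h0 add0r; apply.
by move=> i g1 _ _; rewrite hvecU1 hvec1 addrC entropy_subadd.
Qed.

End JointEntropy.

(** * Cluster points of bounded sequences in finite dimension *)

Lemma bounded_subsequence (u : nat -> R) (b : R) :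
  (forall k, `|u k| <= b) ->
  exists (l : R) (phi : nat -> nat), (forall k, (k <= phi k)%N) /\
    forall k, `|u (phi k) - l| < k.+1%:R^-1.
Proof.
move=> ub; have [l adh] : exists l, ValAdh u l.
  apply: (Bolzano_Weierstrass _ _ (compact_P3 (- b) b)) => k.
  by have := ub k; rewrite ler_norml => /andP[/RleP ? /RleP ?].
have step k : exists j, (k <= j)%N && (`|u j - l| < k.+1%:R^-1).
  have k0 : 0 < k.+1%:R^-1 :> R by rewrite invr_gt0.
  have nb : neighbourhood (disc l (mkposreal _ (elimT RltP k0))) l.
    by exists (mkposreal _ (elimT RltP k0)) => y.
  have [j [kj /RltP jl]] := adh _ k nb; exists j; apply/andP.
  by split; [exact/ssrnat.leP|move: jl; rewrite /= RabsE].
by exists l, (fun k => xchoose (step k)); split=> k; case/andP: (xchooseP (step k)).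
Qed.

(** Subsequences are extracted one coordinate after another and composed. The property [k <= phi k]
    is stable under composition and preserves the limits already obtained. *)
Lemma bounded_subsequence_seq (I : eqType) (r : seq I) (u : nat -> I -> R) (b : R) :
  (forall k i, `|u k i| <= b) ->
  exists (l : I -> R) (phi : nat -> nat), (forall k, (k <= phi k)%N) /\
    forall i, i \in r -> forall eps : R, 0 < eps ->
      exists K, forall k, (K <= k)%N -> `|u (phi k) i - l i| < eps.
Proof.
elim: r u => [|i r IH] u ub; first by exists (fun=> 0), id.
have [a [psi [psi_ge psi_lim]]] := bounded_subsequence (fun k => ub k i).
have [l [phi [phi_ge phi_lim]]] := IH (fun k => u (psi k)) (fun k => ub (psi k)).
exists (fun j => if j == i then a else l j), (psi \o phi); split=> [k|j].
  by apply: leq_trans (phi_ge k) (psi_ge _).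
rewrite inE; case: eqP => [-> _|_ /= jr] eps eps0; last exact: phi_lim.
exists (Num.truncn eps^-1) => k Kk; apply: lt_le_trans (psi_lim _) _.
rewrite -[leRHS]invrK lef_pV2 ?posrE ?invr_gt0 //.
apply/ltW/(lt_le_trans (truncnS_gt _)); rewrite ler_nat ltnS.
exact: leq_trans (phi_ge k).
Qed.

Lemma bounded_cluster_point (I : finType) (u : nat -> I -> R) (b : R) :
  (forall k i, `|u k i| <= b) ->
  exists l : I -> R, forall eps : R, 0 < eps -> forall K,
    exists2 k, (K <= k)%N & forall i, `|u k i - l i| < eps.
Proof.
move=> ub; have [l [phi [phi_ge phi_lim]]] := bounded_subsequence_seq (enum I) ub.
exists l => eps eps0 K.
have /fin_all_exists[Ki KiP] : forall i, exists Ki, forall k,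
    (Ki <= k)%N -> `|u (phi k) i - l i| < eps.
  by move=> i; apply: phi_lim => //; rewrite mem_enum.
pose k := maxn K (\max_i Ki i); exists (phi k).
  by apply: leq_trans (phi_ge k); rewrite leq_maxl.
by move=> i; apply: KiP; rewrite leq_max (leq_bigmax i) orbT.
Qed.

(** * The entropic vector of a code *)

Lemma card_ord_mod q m M a : M = (q * m)%N -> (a < m)%N ->
  #|[pred i : 'I_M | i %% m == a]%N| = q.
Proof.
move=> -> am; have lt (k : 'I_q) : (k * m + a < q * m)%N.
  apply: (@leq_trans (k.+1 * m)%N); first by rewrite mulSn addnC ltn_add2r.
  by rewrite leq_mul2r ltn_ord orbT.
have inj : injective (fun k : 'I_q => Ordinal (lt k)).
  move=> k k' /(congr1 (fun i : 'I__ => i %/ m)%N) /=.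
  have m0 : (0 < m)%N by apply: leq_ltn_trans am.
  by rewrite !divnMDl // divn_small // !addn0 => /val_inj.
rewrite -[RHS]card_ord -(card_codom inj); apply: eq_card => i; rewrite inE.
apply/eqP/codomP => [ia|[k ->]]; last by rewrite /= modnMDl modn_small.
have m0 : (0 < m)%N by apply: leq_ltn_trans am.
have iq : (i %/ m < q)%N by rewrite ltn_divLR.
by exists (Ordinal iq); apply: val_inj; rewrite /= -ia -divn_eq.
Qed.

Section CodeVector.
Variables (V E : finType) (tl hd : E -> V) (S T : {set V}) (beta : V -> {set V}).
Variables (km kk : src S -> nat) (We : E -> nat) (W : E -> Omega km kk -> nat).
Hypothesis code : @is_code V E tl hd S T km kk We W.
Variable cap : src S -> nat.

(** The number of message bits kept at [s]; a [cap] linear in the blocklength keeps the message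
    coordinate O(n). *)
Let bits s := minn (km s) (cap s).
Let D (s : src S) : finType := ('I_(2 ^ km s)%N * 'I_(2 ^ kk s)%N)%type.

Let exp2_gt0 k : (0 < 2 ^ k)%N. Proof. by rewrite expn_gt0. Qed.

Let w0 : Omega km kk :=
  [ffun s => (Ordinal (exp2_gt0 (km s)), Ordinal (exp2_gt0 (kk s)))].

Let W_lt e w : (W e w < We e)%N. Proof. by case: code. Qed.

Let We_gt0 e : (0 < We e)%N. Proof. exact: leq_ltn_trans (W_lt e w0). Qed.

Let D_gt0 s : (0 < #|D s|)%N.
Proof. by rewrite card_prod !card_ord muln_gt0 !exp2_gt0. Qed.

Let Om_gt0 : (0 < #|Omega km kk|)%N. Proof. exact: card_dffun_gt0. Qed.

Let low s (d : D s) : 'I_(2 ^ bits s) := Ordinal (ltn_pmod d.1 (exp2_gt0 (bits s))).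

(** The high message bits and the key are free. The count does not depend on [a], which is the
    equal-fibre hypothesis of the functional representation. *)
Let card_low s a :
  #|[pred d : D s | low d == a]| = (2 ^ (km s - bits s) * 2 ^ kk s)%N.
Proof.
have kmE : (2 ^ km s = 2 ^ (km s - bits s) * 2 ^ bits s)%N.
  by rewrite -expnD subnK // geq_minl.
rewrite -(card_ord_mod kmE (ltn_ord a)).
rewrite -[X in (_ * X)%N]card_ord -cardX; apply: eq_card => -[i j].
by rewrite !inE /= andbT -val_eqE.
Qed.

(** The functional representation over the fibres of [low], applied to the tuple of edge symbols. As
    [z] depends on the whole pair at [s], it also absorbs the discarded message bits. *)
Lemma exists_reduced_key (s : src S) :
  exists z : D s -> nat,
    [/\ forall d, (z d < 2 ^ bits s * \prod_e We e)%N,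
        forall w w' : Omega km kk, low (w s) = low (w' s) -> z (w s) = z (w' s) ->
          forall e, tl e = val s -> W e w = W e w' &
        forall a k, (#|[pred d | (low d == a) && (z d == k)]| * 2 ^ bits s
                     = #|[pred d | z d == k]|)%N].
Proof.
(* The other sources are filled in by [w0]. Edges leaving [s] do not see this choice; recording the
   remaining edges as well keeps the bound a product over all edges. *)
pose ext (d : D s) : Omega km kk := [ffun s' => dfwith (fun s' => w0 s') d s'].
pose sym w : {dffun forall e, 'I_(We e)} := [ffun e => Ordinal (W_lt e w)].
pose f d : nat := enum_rank (sym (ext d)).
have f_lt d : (f d < \prod_e We e)%N.
  rewrite (leq_trans (ltn_ord _)) // card_dffunE.
  by rewrite (eq_bigr We) // => e _; rewrite card_ord.
have [z [z_lt zf ind]] := functional_representation (@card_low s) f_lt.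
exists z; split=> [d|w w' lw zw e te|a k].
- by have := z_lt d; rewrite card_ord.
- have [_ /(_ s e te) [eta etaE] _] := code.
  have WE w1 : W e w1 = W e (ext (w1 s)) by rewrite !etaE /ext ffunE dfwith_in.
  have := zf _ _ lw zw; rewrite /f => /val_inj/enum_rank_inj/ffunP/(_ e).
  by rewrite !ffunE => /(congr1 val) /=; rewrite -!WE.
- by rewrite -(ind a) card_ord.
Qed.

Section WithKey.
Variable z : forall s, D s -> nat.
Hypothesis z_lt : forall s (d : D s), (z d < 2 ^ bits s * \prod_e We e)%N.
Hypothesis zW : forall s (w w' : Omega km kk),
  low (w s) = low (w' s) -> z (w s) = z (w' s) ->
  forall e, tl e = val s -> W e w = W e w'.
Hypothesis z_indep : forall s a k,
  (#|[pred d : D s | (low d == a) && (z d == k)]| * 2 ^ bits s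
   = #|[pred d : D s | z d == k]|)%N.

Let U (i : lab E S) (w : Omega km kk) : nat :=
  match i with
  | Lm s => low (w s)
  | Lk s => z (w s)
  | Le e => W e w
  end.

Let p := @unif (Omega km kk).
Let p_gt0 w : 0 < p w. Proof. exact: unif_gt0. Qed.
Let p_sum1 : \sum_w p w = 1. Proof. exact: unif_sum1. Qed.

Let h := hvec p U.

Lemma code_entropic : entropic h.
Proof. by exists (Omega km kk), p, U; split=> //; exact: unif_is_pmf. Qed.

Lemma code_h_msg s : h [set Lm E s] = (bits s)%:R.
Proof.
rewrite /h hvec1 // (@entropy_const_law _ _ _ _ (2 ^ bits s)%:R^-1) //.
  by rewrite log2V ?ltr0n // opprK log2_exp2.
move=> w; rewrite (@law_marginal _ D D_gt0 _ s (fun d => low d : nat)).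
rewrite (_ : law _ _ _ = law (@unif (D s)) (@low s) (low (w s))).
  by rewrite (law_balanced (D_gt0 s) (@card_low s)) card_ord.
by apply: eq_bigl => d.
Qed.

(** Across sources, independence comes from the product space; within a source, from the balance of
    [z] over the fibres of [low]. *)
Lemma code_Gamma1 : Gamma1 h.
Proof.
rewrite /Gamma1 /h {1}/hvec.
rewrite (@entropy_product _ D D_gt0 _ _ (fun s => (nat * nat)%type)
   (fun s d => (low d : nat, z d))); last first.
  move=> w w'; apply/eqP/forallP => [/projP e s|e].
    by apply/eqP; congr (_, _); [apply: (e (Lm E s))|apply: (e (Lk E s))]; rewrite inE.
  by apply/projP => -[s _|s _|e']; rewrite ?inE //; have /eqP[] := e s.
apply: eq_bigr => s _; rewrite !hvec1 //=; apply: entropy_indep => // w.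
rewrite (@law_marginal _ D D_gt0 _ s (fun d => (low d : nat, z d))).
rewrite (@law_marginal _ D D_gt0 _ s (fun d => low d : nat)).
rewrite (@law_marginal _ D D_gt0 _ s (@z s)).
have := @law_balanced_indep _ _ _ _ (D_gt0 s) (@card_low s) (@z s) _ (low (w s)) (z (w s)).
rewrite card_ord => /(_ (z_indep (s:=s))) ind.
by move: ind; rewrite /law => ind; rewrite -[RHS]ind; apply: eq_bigl => d.
Qed.

Lemma code_Gamma2 : Gamma2 tl h.
Proof.
move=> s; apply: hvec_determined => //; first exact: subsetUl.
move=> w w' e i /setUP[|/imsetP[a]]; first exact: e.
rewrite inE => /eqP ta ->; apply: (@zW s) => //.
  by apply: val_inj; apply: (e (Lm E s)); rewrite !inE eqxx.
by apply: (e (Lk E s)); rewrite !inE eqxx orbT.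
Qed.

Lemma restr_eq v (w w' : Omega km kk) :
  (forall i, i \in elabs S (In_ hd v) -> U i w = U i w') ->
  forall e, restr hd v (fun e => W e w) e = restr hd v (fun e => W e w') e.
Proof.
move=> eq e; rewrite /restr; case: ifP => // he.
by apply: (eq (Le S e)); apply: imset_f; rewrite inE.
Qed.

Lemma code_Gamma3 : Gamma3 tl hd T h.
Proof.
move=> v; rewrite inE negb_or => /andP[vS vT].
apply: hvec_determined => //; first by apply: imsetS; exact: subsetUl.
move=> w w' eq i /imsetP[e /setUP[ev|ev] ->].
  by apply: eq; apply: imset_f.
move: ev; rewrite inE => /eqP tv; have [_ _ /(_ e)] := code.
rewrite tv => /(_ vS vT)[eta etaE]; rewrite /= !etaE; congr eta.
by apply: functional_extensionality; exact: restr_eq.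
Qed.

Lemma code_h_edge e : h [set Le S e] <= log2 (We e)%:R.
Proof. by rewrite /h hvec1 //; apply: entropy_le_log2 => // w; exact: W_lt. Qed.

Lemma code_h_key s :
  h [set Lk E s] <= (bits s)%:R + \sum_e log2 (We e)%:R.
Proof.
rewrite /h hvec1 // -log2_exp2 -log2_prod; last by move=> e; rewrite ltr0n.
rewrite -natr_prod -log2M ?ltr0n ?prodn_gt0 // -natrM.
by apply: entropy_le_log2 => // w; exact: z_lt.
Qed.

(** The kept bits are a function of the messages, so by data processing they leak no more than the
    messages do. *)
Lemma code_secrecy (al : {set E}) :
  0 <= h (mlabs E S) + h (elabs S al) - h (mlabs E S :|: elabs S al)
    <= mutinf p (@MS V S km kk) (Walpha W al).
Proof.
rewrite /h hvecU // -[_ - _]/(mutinf p (proj U (mlabs E S)) (proj U (elabs S al))).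
rewrite mutinf_ge0 //=.
have -> : mutinf p (@MS V S km kk) (Walpha W al)
    = mutinf p (@MS V S km kk) (proj U (elabs S al)).
  have eqv w w' : Walpha W al w = Walpha W al w' <->
      proj U (elabs S al) w = proj U (elabs S al) w'.
    rewrite projP; split=> [/ffunP eq i /imsetP[e ea ->]|eq].
      by have := eq e; rewrite !ffunE ea.
    apply/ffunP => e; rewrite !ffunE; case: ifP => // ea.
    by apply: (eq (Le S e)); apply: imset_f.
  rewrite !mutinfE (entropy_eq p_gt0 eqv); congr (_ - _).
  by apply: entropy_eq => // w w'; split=> -[-> /eqv ->].
apply: data_processing => // w w' /ffunP eq.
apply/projP => -[s _|s|e]; rewrite ?inE //=.
by have := eq s; rewrite !ffunE => ->.
Qed.

Let err t (dec : src S -> (E -> nat) -> nat) s := prob p (fun w =>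
  dec s (restr hd t (fun e => W e w)) != nat_of_ord (w s).1).

(** Fano's inequality for each demanded message in turn, given the incoming edges and the messages
    already added. *)
Lemma code_decoding t dec :
  let mt := [set Lm E s | s in [pred s : src S | val s \in beta t]] in
  (h (elabs S (In_ hd t)) <= h (mt :|: elabs S (In_ hd t))) /\
  (h (mt :|: elabs S (In_ hd t)) <= h (elabs S (In_ hd t))
     + \sum_(s | val s \in beta t) (1 + err t dec s * (bits s)%:R)).
Proof.
move=> mt; split; first by apply: hvec_mono => //; exact: subsetUr.
pose delta (i : lab E S) : R := if i is Lm s then 1 + err t dec s * (bits s)%:R else 0.
pose r := [seq Lm E s | s <- enum [pred s : src S | val s \in beta t]].
have -> : \sum_(s | val s \in beta t) (1 + err t dec s * (bits s)%:R)
    = \sum_(i <- r) delta i by rewrite big_map big_enum.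
have -> : mt = [set i in r].
  apply/setP => i; rewrite inE; apply/imsetP/mapP => -[s sb ->]; exists s => //.
    by rewrite mem_enum.
  by rewrite mem_enum in sb.
apply: hvec_chain => // i g /mapP[s _ ->] sub; rewrite hvecU1 //=.
(* The decoder's output is truncated like the message. A wrong truncated estimate implies a wrong
   full one, so the error probability does not grow. *)
pose ghat w := (dec s (restr hd t (fun e => W e w)) %% 2 ^ bits s)%N.
apply: le_trans (@fano _ _ p_gt0 p_sum1 _ _ (proj U g) ghat (2 ^ bits s)%N _ _ _) _.
- exact: exp2_gt0.
- by move=> w; exact: ltn_pmod.
- move=> w w' /projP eq; rewrite /ghat; congr (dec s _ %% _)%N.
  apply: functional_extensionality; apply: restr_eq => i0 it.
  by apply: eq; apply: (subsetP sub).
rewrite lerD2l lerD2l log2_exp2 ler_wpM2r //.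
rewrite /err /prob [leRHS](bigID (fun w => ghat w != low (w s))) /=.
rewrite [X in _ <= X + _](eq_bigl (fun w => ghat w != low (w s))); last first.
  move=> w; rewrite /ghat /=; case: (dec s _ =P nat_of_ord (w s).1) => [->|] //.
  by rewrite eqxx.
by rewrite lerDl sumr_ge0 // => w _; exact: ltW.
Qed.

End WithKey.
(** Fixes a reduced key at every source and collects what the limit argument uses, so that the keys
    themselves no longer appear. *)
Lemma code_vector (dec : V -> src S -> (E -> nat) -> nat) :
  exists h : vec E S,
  [/\ [/\ entropic h, Gamma1 h, Gamma2 tl h & Gamma3 tl hd T h],
      (forall g, 0 <= h g <= \sum_i h [set i]),
      [/\ forall s, h [set Lm E s] = (bits s)%:R,
          forall s, h [set Lk E s] <= (bits s)%:R + \sum_e log2 (We e)%:R &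
          forall e, h [set Le S e] <= log2 (We e)%:R],
      (forall al : {set E},
         0 <= h (mlabs E S) + h (elabs S al) - h (mlabs E S :|: elabs S al)
           <= mutinf (@unif (Omega km kk)) (@MS V S km kk) (Walpha W al)) &
      (forall t,
         let mt := [set Lm E s | s in [pred s : src S | val s \in beta t]] in
         (h (elabs S (In_ hd t)) <= h (mt :|: elabs S (In_ hd t))) /\
         (h (mt :|: elabs S (In_ hd t)) <= h (elabs S (In_ hd t))
           + \sum_(s | val s \in beta t)
               (1 + prob (@unif (Omega km kk)) (fun w =>
                      dec t s (restr hd t (fun e => W e w)) != nat_of_ord (w s).1)
                    * (bits s)%:R)))].
Proof.
have [z zP] := fin_all_exists exists_reduced_key.
have z_lt s (d : D s) : (z s d < 2 ^ bits s * \prod_e We e)%N by case: (zP s).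
have zW s : forall w w' : Omega km kk, low (w s) = low (w' s) ->
    z s (w s) = z s (w' s) -> forall e, tl e = val s -> W e w = W e w'.
  by case: (zP s).
have z_indep s : forall a k, (#|[pred d : D s | (low d == a) && (z s d == k)]|
    * 2 ^ bits s = #|[pred d : D s | z s d == k]|)%N by case: (zP s).
eexists; split.
- split; first exact: (code_entropic z).
  + exact: code_Gamma1.
  + exact: code_Gamma2.
  + exact: code_Gamma3.
- have p1 := unif_sum1 Om_gt0.
  move=> g; rewrite hvec_ge0 ?hvec_le_sum //; exact: unif_gt0.
- split=> [s|s|e]; [exact: code_h_msg|exact: code_h_key|exact: code_h_edge].
- exact: code_secrecy.
- by move=> t; exact: code_decoding.
Qed.

End CodeVector.

(** * Normalisation by the blocklength and passage to the limit *)

Section OuterBound.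
Variables (V E : finType) (tl hd : E -> V) (S T : {set V}) (beta : V -> {set V}).
Variables (c : E -> R) (A : {set {set E}}).

Let inner (h : vec E S) := [/\ entropic h, Gamma1 h, Gamma2 tl h & Gamma3 tl hd T h].

Let mt t := [set Lm E s | s in [pred s : src S | val s \in beta t]].

Lemma inner0 : inner (fun=> 0).
Proof.
split=> //; last by rewrite /Gamma1 big1 // => s _; rewrite addr0.
have u0 : (0 < #|{: unit}|)%N by rewrite card_unit.
exists unit, (@unif unit), (fun _ _ => 0%N); split=> [|g]; first exact: unif_is_pmf.
by rewrite entropy_const_fun // unif_sum1.
Qed.

Lemma clcon_scale (h : vec E S) (l : R) :
  0 <= l -> l <= 1 -> inner h -> clcon inner (fun g => l * h g).
Proof.
move=> l0 l1 hP C convC closC sub; apply: closC => eps eps0.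
(* This convex combination with the zero vector agrees with the target pointwise; closedness of [C]
   replaces an appeal to extensionality. *)
exists (fun g => l * h g + (1 - l) * 0); split.
  by apply: convC => //; apply: sub => //; exact: inner0.
by move=> g; rewrite mulr0 addr0 subrr normr0.
Qed.

(** The outer bound with tolerance [eps] in the decoding, secrecy and rate conditions; the
    capacities are respected exactly. The bound [b] is a separate parameter because compactness
    requires it to be the same for all [eps]. *)
Definition approx_outer (r : src S -> R) (b eps : R) (h : vec E S) : Prop :=
  [/\ clcon inner h,
      (forall g, `|h g| <= b),
      (forall t, t \in T ->
         `|h (mt t :|: elabs S (In_ hd t)) - h (elabs S (In_ hd t))| <= eps),
      (forall e, h [set Le S e] <= c e) /\ (forall s, r s - eps <= h [set Lm E s]) &
      (forall al, al \in A ->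
         `|h (mlabs E S) + h (elabs S al) - h (mlabs E S :|: elabs S al)| <= eps)].

Lemma achievable_approx (r : src S -> R) :
  (forall e, 0 <= c e) -> @achievable_w V E tl hd S T beta c A r ->
  exists b, forall eps, 0 < eps -> exists h, approx_outer r b eps h.
Proof.
(* [Rn s] exceeds [r s], so keeping [n * Rn s] message bits costs no required rate. *)
move=> c0 ach; pose Rn s := (Num.truncn (r s)).+1.
have r_le s : r s <= (Rn s)%:R by exact/ltW/truncnS_gt.
pose sR := \sum_s (Rn s)%:R : R; pose sc := \sum_e c e.
have Rn_le s : (Rn s)%:R <= sR.
  by rewrite /sR (bigD1 s) //= lerDl sumr_ge0.
have c_le e : c e <= sc by rewrite /sc (bigD1 e) //= lerDl sumr_ge0.
have sR0 : 0 <= sR by rewrite sumr_ge0.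
have sc0 : 0 <= sc by rewrite sumr_ge0.
(* After division by [n], a singleton coordinate is at most [sR] for a message, [sR + sc] for a key
   and [sc] for an edge; [hvec_le_sum] then gives one such term per label. *)
exists (#|{: lab E S}|%:R * (sR + sc)) => eps eps0.
(* The Fano terms will add up to at most [eps / K * (K - 1)]. The summand 1 gives [1 <= K], hence
   [eps / K <= eps]. *)
pose K := 1 + #|{: src S}|%:R + sR.
have K1 : 1 <= K by rewrite /K -addrA lerDl addr_ge0.
have K0 : 0 < K by apply: lt_le_trans K1.
have eK0 : 0 < eps / K by rewrite divr_gt0.
have eK_ge0 := ltW eK0.
have eK_le : eps / K <= eps by rewrite ler_pdivrMr // ler_peMr // ltW.
(* Taking [n] above [(eps / K)^-1] makes the constant 1 in each Fano term contribute at most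
   [eps / K]. *)
have [N /(_ (maxn N (Num.truncn (eps / K)^-1).+1))] := ach _ eK0.
set n := maxn _ _ => /(_ (leq_maxl _ _)).
have n_gt : (Num.truncn (eps / K)^-1 < n)%N by exact: leq_maxr.
have n0 : (0 < n)%N by apply: leq_ltn_trans n_gt.
have nR : 0 < n%:R :> R by rewrite ltr0n.
have n_inv : n%:R^-1 <= eps / K.
  rewrite -[leRHS]invrK lef_pV2 ?posrE ?invr_gt0 //.
  by apply/ltW/(lt_le_trans (truncnS_gt _)); rewrite ler_nat.
move=> /(_ n0) [km [kk [We [W [dec [code rate edge sec decode]]]]]].
have [h [hP h_bd [h_m h_k h_e] h_sec h_dec]] :=
  code_vector beta code (fun s => n * Rn s)%N dec.
have invn0 : 0 <= n%:R^-1 :> R by rewrite invr_ge0 ler0n.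
have bits_le s : n%:R^-1 * (minn (km s) (n * Rn s))%:R <= (Rn s)%:R :> R.
  by rewrite mulrC ler_pdivrMr // -natrM ler_nat mulnC geq_minr.
have h1_le i : n%:R^-1 * h [set i] <= sR + sc.
  case: i => [s|s|e].
  - by rewrite h_m (le_trans (bits_le s)) // (le_trans (Rn_le s)) // lerDl.
  - apply: le_trans (ler_wpM2l invn0 (h_k s)) _.
    rewrite mulrDr lerD //; first exact: le_trans (bits_le s) (Rn_le s).
    by rewrite mulr_sumr ler_sum // => e _; rewrite mulrC.
  - apply: le_trans (ler_wpM2l invn0 (h_e e)) _.
    by rewrite mulrC (le_trans (edge e)) // (le_trans (c_le e)) // lerDr.
exists (fun g => n%:R^-1 * h g); split.
- apply: clcon_scale => //.
  by rewrite invf_le1 // ler1n.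
- move=> g; have /andP[h0 hs] := h_bd g.
  rewrite ger0_norm ?mulr_ge0 //.
  apply: le_trans (ler_wpM2l invn0 hs) _; rewrite mulr_sumr.
  apply: le_trans (ler_sum _ (fun i _ => h1_le i)) _.
  by rewrite sumr_const mulr_natl.
- move=> t tT; have [lo hi] := h_dec t.
  rewrite -mulrBr ger0_norm ?mulr_ge0 ?subr_ge0 //.
  apply: (@le_trans _ _ (n%:R^-1 * \sum_(s | val s \in beta t)
      (1 + eps / K * (minn (km s) (n * Rn s))%:R))).
    rewrite ler_wpM2l // lerBlDl; apply: le_trans hi _.
    rewrite lerD2l ler_sum // => s sb; rewrite lerD2l ler_wpM2r //.
    exact: decode.
  rewrite mulr_sumr; apply: (@le_trans _ _ (\sum_s (eps / K + eps / K * (Rn s)%:R))).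
    rewrite [leRHS](bigID (fun s => val s \in beta t)) /= ler_wpDr //.
      by rewrite sumr_ge0 // => s _; rewrite addr_ge0 // mulr_ge0.
    rewrite ler_sum // => s _; rewrite mulrDr mulr1 lerD //.
    by rewrite mulrCA ler_pM2l.
  rewrite big_split /= sumr_const -mulr_sumr -/sR -[X in X + _]mulr_natl.
  have -> : #|{: src S}|%:R * (eps / K) + eps / K * sR = eps / K * (K - 1).
    by rewrite /K; ring.
  by rewrite mulrBr divfK ?lt0r_neq0 // mulr1 gerBl ltW.
- split=> [e|s].
    by rewrite (le_trans (ler_wpM2l invn0 (h_e e))) // mulrC edge.
  (* Either the whole message is kept and the code's rate condition applies, or exactly [Rn s] bits
     per channel use are kept. *)
  rewrite h_m /minn; case: ifP => _.
    by rewrite mulrC (le_trans _ (rate s)) // lerB.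
  rewrite natrM mulKf ?lt0r_neq0 // (le_trans _ (r_le s)) // gerBl ltW //.
- move=> al alA; have /andP[lo hi] := h_sec al.
  rewrite -mulrDr -mulrBr ger0_norm ?mulr_ge0 //.
  apply: le_trans (ler_wpM2l invn0 hi) _.
  by rewrite mulrC (le_trans (sec al alA)).
Qed.

(** Takes a cluster point of vectors with tolerances 1/(k+1). Every closed convex set containing
    [inner] contains these vectors and hence the limit; each other condition involves finitely many
    coordinates. *)
Lemma approx_outer_limit (r : src S -> R) b :
  (forall eps, 0 < eps -> exists h, approx_outer r b eps h) ->
  @outer_bound V E tl hd S T beta c A r.
Proof.
move=> app.
have inv0 k : 0 < k.+1%:R^-1 :> R by rewrite invr_gt0.
pose u k := proj1_sig (constructive_indefinite_description _ (app _ (inv0 k))).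
have uP k : approx_outer r b k.+1%:R^-1 (u k) by rewrite /u; case: constructive_indefinite_description.
have [l lP] := @bounded_cluster_point _ u b (fun k => let: And5 _ ub _ _ _ := uP k in ub).
have near eps : 0 < eps -> exists k, k.+1%:R^-1 <= eps /\ forall g, `|u k g - l g| < eps.
  move=> eps0; have [k kK kl] := lP eps eps0 (Num.truncn eps^-1).
  exists k; split=> //; rewrite -[leRHS]invrK lef_pV2 ?posrE ?invr_gt0 //.
  by apply/ltW/(lt_le_trans (truncnS_gt _)); rewrite ler_nat ltnS.
(* The factor 4 covers the worst case, the secrecy condition: three coordinates, each off by [eps],
   plus the tolerance. *)
have closed_le (x y : R) : (forall eps : R, 0 < eps -> x <= y + 4 * eps) -> x <= y.
  move=> xy; apply/ler_addgt0Pr => eps eps0.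
  have e4 : 0 < eps / 4 by lra.
  by have := xy _ e4; lra.
exists l; split.
- move=> C convC closC sub; apply: (closC) => eps eps0.
  have [k [_ kl]] := near _ eps0; exists (u k); split; last by move=> g; rewrite distrC.
  by have [hC _ _ _ _] := uP k; exact: hC.
- move=> t tT; apply/le_anti/andP; split; apply: closed_le => eps eps0;
    have [k [ke kl]] := near _ eps0; have [_ _ /(_ t tT)/le_trans/(_ ke) h4 _ _] := uP k;
    have := kl (mt t :|: elabs S (In_ hd t)); have := kl (elabs S (In_ hd t));
    move: h4; rewrite !ltr_norml !ler_norml -/(mt t) => /andP[? ?] /andP[? ?] /andP[? ?]; clear ke; lra.
- move=> e; apply: closed_le => eps eps0.
  have [k [ke kl]] := near _ eps0; have [_ _ _ [/(_ e) h5 _] _] := uP k.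
  by have := kl [set Le S e]; rewrite ltr_norml => /andP[? ?]; lra.
- move=> al alA; apply/le_anti/andP; split; apply: closed_le => eps eps0;
    have [k [ke kl]] := near _ eps0; have [_ _ _ _ /(_ al alA)/le_trans/(_ ke) h6] := uP k;
    have := kl (mlabs E S :|: elabs S al); have := kl (elabs S al);
    have := kl (mlabs E S); move: h6; rewrite !ltr_norml !ler_norml;
    move=> /andP[? ?] /andP[? ?] /andP[? ?] /andP[? ?]; clear ke; lra.
- move=> s; apply: closed_le => eps eps0.
  have [k [ke kl]] := near _ eps0; have [_ _ _ [_ /(_ s) hm] _] := uP k.
  have {ke}hm : r s - eps <= u k [set Lm E s] by apply: le_trans hm; rewrite lerB.
  by have := kl [set Lm E s]; rewrite ltr_norml => /andP[? ?]; lra.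
Qed.

End OuterBound.

Theorem theorem5 (V E : finType) (tl hd : E -> V) (S T : {set V})
    (beta : V -> {set V}) (c : E -> R) (A : {set {set E}}) :
  wiretap_network tl hd S T beta c ->
  forall r : src S -> R,
    @achievable_w V E tl hd S T beta c A r ->
    @outer_bound V E tl hd S T beta c A r.
Proof.
move=> [_ _ _ _ c0] r /(achievable_approx c0)[b app].
exact: approx_outer_limit app.
Qed.
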